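(* The randomized modified multiplicative price update algorithm is a universally truthful mechanism without money and with verification for CAs with unknown $k$-minded bidders and goods of supply $b$; it always outputs an allocation in which each good is allocated at most $b$ times, and its expected approximation ratio is $O(d^{1/b}\log(bm))$, where $d$ is the maximum cardinality of a demanded set with positive valuation.
   Context: Multi-unit combinatorial auction: a set $\mathsf U$ of $m$ goods, each with supply $b\ge1$; $n$ bidders. True type of bidder $i$: $t_i=(v_i,\mathcal S_i)$ with $\mathcal S_i$ a private collection of $k$ nonempty subsets of $\mathsf U$ and $v_i:\mathcal S_i\to\mathbb R_{\ge0}$ private, extended by $v_i(T)=\max\{v_i(S'):S'\in\mathcal S_i,S'\subseteq T\}$ ($0$ if none). Declarations $(w,\mathcal W)$ have the same form. Randomized modified algorithm on declarations $(w_i,\mathcal W_i)$: let $v^i_{\max}=\max_{S\in\mathcal W_i}w_i(S)$, $j$ the bidder with largest $v^j_{\max}$ (smallest index on ties), $\mu=(1+\epsilon)v^j_{\max}$ for fixed $0<\epsilon\ll1$, $p_0=\mu/(4bm)$, $r=2^{1/b}$, $q=1/(2\mathrm e\, d^{1/b}\log(4bm))$; initially each good $e$ has price $p_e=p_0$ and remaining supply $b_e=b$. Process bidders in order $j,1,\dots,j-1,j+1,\dots,n$; for bidder $i$: let $\mathsf U_i=\{e:b_e>0\}$, let $S_i$ maximize $w_i(S)$ over $S\in\mathcal W_i$ with $S\subseteq\mathsf U_i$ and $w_i(S)\ge\sum_{e\in S}p_e$ ($\emptyset$ if none); multiply $p_e$ by $r$ for $e\in S_i$; set $R_i=S_i$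 if $i=j$, and otherwise $R_i=S_i$ with probability $q$ and $R_i=\emptyset$ with probability $1-q$ (independently); decrease $b_e$ by one for every $e\in R_i$. Output $(R_1,\dots,R_n)$. Verification: bidder $i$ with true type $t_i$ facing $\mathbf b_{-i}$ may declare $b_i=(z,\mathcal T)$ only if $z(A_i(b_i,\mathbf b_{-i}))\le v_i(A_i(b_i,\mathbf b_{-i}))$. A deterministic mechanism is truthful without money and with verification if for all $i$, $\mathbf b_{-i}$, true $t_i$ and permitted $b_i$, $v_i(A_i(t_i,\mathbf b_{-i}))\ge v_i(A_i(b_i,\mathbf b_{-i}))$; a randomized mechanism is universally truthful if it is a probability distribution over such deterministic mechanisms. Expected approximation ratio $\alpha$: on every truthful input, the expected social welfare is at least $\mathrm{OPT}/\alpha$, $\mathrm{OPT}$ being the maximum welfare of an allocation giving each good at most $b$ times. *)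

(* Defs.v *)
From mathcomp Require Import all_boot.
From Stdlib Require Import Reals.
Set Implicit Arguments. Unset Strict Implicit. Unset Printing Implicit Defensive.
Local Open Scope R_scope.

(* A declaration (w, W): a list of pairs (S, w(S)). Goods are 'I_m. *)
Definition decl (m : nat) := seq ({set 'I_m} * R).

Definition valid_decl (m k : nat) (D : decl m) : Prop :=
  size D = k /\ uniq (map fst D) /\
  (forall p, List.In p D -> p.1 != set0 /\ 0 <= p.2).

Definition value (m : nat) (D : decl m) (T : {set 'I_m}) : R :=
  foldr (fun (p : {set 'I_m} * R) acc => if p.1 \subset T then Rmax p.2 acc else acc) 0 D.

Definition Rleb (x y : R) : bool := if Rle_dec x y then true else false.
Definition Rltb (x y : R) : bool := if Rlt_dec x y then true else false.

Definition Rsum (T : Type) (f : T -> R) (s : seq T) : R :=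
  foldr (fun x acc => f x + acc) 0 s.

Definition price_sum (m : nat) (p : 'I_m -> R) (S : {set 'I_m}) : R :=
  Rsum p (enum S).

Definition choose_set (m : nat) (p : 'I_m -> R) (sup : 'I_m -> nat)
    (D : decl m) : {set 'I_m} :=
  let U := [set e | leq 1 (sup e)] in
  let best := foldl (fun acc (x : {set 'I_m} * R) =>
     if (x.1 \subset U) && Rleb (price_sum p x.1) x.2 then
       match acc with
       | None => Some x
       | Some y => if Rltb y.2 x.2 then Some x else acc
       end
     else acc) None D in
  match best with None => set0 | Some x => x.1 end.

Record state (m n : nat) := St {
  prices : 'I_m -> R;
  supply : 'I_m -> nat;
  alloc  : 'I_n -> {set 'I_m} }.

Definition step (m n : nat) (r : R) (j : 'I_n) (c : 'I_n -> bool)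
    (bids : 'I_n -> decl m) (st : state m n) (i : 'I_n) : state m n :=
  let S := choose_set (prices st) (supply st) (bids i) in
  let Ri := if (i == j) || c i then S else set0 in
  St (fun e => if e \in S then prices st e * r else prices st e)
     (fun e => if e \in Ri then (supply st e).-1 else supply st e)
     (fun i' => if i' == i then Ri else alloc st i').

Definition vmax (m : nat) (D : decl m) : R :=
  foldr (fun (x : {set 'I_m} * R) acc => Rmax x.2 acc) 0 D.

Definition top_bidder (m n : nat) (bids : 'I_n -> decl m) : option 'I_n :=
  foldl (fun acc i => match acc with
                      | None => Some i
                      | Some j => if Rltb (vmax (bids j)) (vmax (bids i))
                                  then Some i else acc end) None (enum 'I_n).

(* The deterministic mechanism obtained by fixing the coin outcomes c. *)
Definition mech (m n b : nat) (eps : R) (c : 'I_n -> bool)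
    (bids : 'I_n -> decl m) : 'I_n -> {set 'I_m} :=
  match top_bidder bids with
  | None => fun _ => set0
  | Some j =>
    let mu := (1 + eps) * vmax (bids j) in
    let p0 := mu / (4 * INR b * INR m) in
    let r := Rpower 2 (/ INR b) in
    let st0 := St (fun _ : 'I_m => p0) (fun _ : 'I_m => b)
                  (fun _ : 'I_n => (set0 : {set 'I_m})) in
    let order := j :: [seq i <- enum 'I_n | i != j] in
    alloc (foldl (step r j c bids) st0 order)
  end.
Arguments mech : clear implicits.

Definition qprob (b m d : nat) : R :=
  / (2 * exp 1 * Rpower (INR d) (/ INR b) * ln (4 * INR b * INR m)).

Definition coin_weight (n : nat) (q : R) (c : {ffun 'I_n -> bool}) : R :=
  foldr (fun i acc => (if c i then q else 1 - q) * acc) 1 (enum 'I_n).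

Definition welfare (m n : nat) (t : 'I_n -> decl m)
    (X : 'I_n -> {set 'I_m}) : R :=
  Rsum (fun i => value (t i) (X i)) (enum 'I_n).

Definition exp_welfare (m n b d : nat) (eps : R) (t : 'I_n -> decl m) : R :=
  Rsum (fun c : {ffun 'I_n -> bool} =>
          coin_weight (qprob b m d) c * welfare t (mech m n b eps c t))
       (enum {ffun 'I_n -> bool}).
Arguments exp_welfare : clear implicits.

Definition feasible (m n b : nat) (X : 'I_n -> {set 'I_m}) : Prop :=
  forall e : 'I_m, leq #|[set i | e \in X i]| b.

Definition upd (n : nat) (A : Type) (f : 'I_n -> A) (i : 'I_n) (x : A) :=
  fun j => if j == i then x else f j.

Definition truthful_verif (m n k : nat)
    (A : ('I_n -> decl m) -> 'I_n -> {set 'I_m}) : Prop :=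
  forall (bids : 'I_n -> decl m) (i : 'I_n) (t b' : decl m),
    (forall j, j != i -> valid_decl k (bids j)) ->
    valid_decl k t -> valid_decl k b' ->
    value b' (A (upd bids i b') i) <= value t (A (upd bids i b') i) ->
    value t (A (upd bids i b') i) <= value t (A (upd bids i t) i).

Definition universally_truthful (m n b k : nat) (eps : R) : Prop :=
  forall c : {ffun 'I_n -> bool}, truthful_verif k (mech m n b eps c).

(* Main.v *)
From HB Require Import structures.
Require Import Defs.
From mathcomp Require Import all_boot.
From Stdlib Require Import Reals Lra Factorial.
Set Implicit Arguments. Unset Strict Implicit. Unset Printing Implicit Defensive.
Local Open Scope R_scope.

(** Truthfulness.  The choice rule only competes with sets that are available
    and worth their price; verification says that the set won by a lie is truly
    worth at least its declared value, hence its price, so the truthful choice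
    at the same prices is at least as good.  A lie can change the prices seen by
    a bidder only by changing the top bidder, and the top bidder obtains the
    maximum of his valuation.

    Approximation.  Let V be the top declared value.  A good of price p can be
    requested at most 1 + b log2 (V / p) more times, so with x := that number
    times q, the quantity x^s / s! is a supermartingale which equals 1 once the
    supply s is 0.  An induction along the run shows that twice the expected
    welfare of the bidders that come after the top one is at least q times
    [the sum of v_i(Y_i) (1 - potential of Y_i), minus the prices of the Y_i],
    for every family Y of sets using each good at most b times.  Just after the
    top bidder has been served, the potential of a good outside his set is at
    most 5/(9d); the goods inside his set have one copy less, and their total
    potential costs only O(d^(1/b)) V, which the top bidder's own welfare V
    pays for. *)

(** * Finite sums and products of real numbers *)

HB.instance Definition _ := Monoid.isComLaw.Build R 0 Rplus
  (fun x y z => esym (Rplus_assoc x y z)) Rplus_comm Rplus_0_l.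
HB.instance Definition _ := Monoid.isComLaw.Build R 1 Rmult
  (fun x y z => esym (Rmult_assoc x y z)) Rmult_comm Rmult_1_l.
HB.instance Definition _ := Monoid.isMulLaw.Build R 0 Rmult Rmult_0_l Rmult_0_r.
HB.instance Definition _ := Monoid.isAddLaw.Build R Rmult Rplus
  Rmult_plus_distr_r Rmult_plus_distr_l.

Local Notation "\sum_ ( i <- r ) F" := (\big[Rplus/0]_(i <- r) F) : R_scope.
Local Notation "\sum_ ( i 'in' A ) F" := (\big[Rplus/0]_(i in A) F) : R_scope.
Local Notation "\sum_ ( i : T ) F" := (\big[Rplus/0]_(i : T) F) : R_scope.
Local Notation "\sum_ i F" := (\big[Rplus/0]_i F) : R_scope.

Section RealSums.
Variables (I : Type).
Implicit Types (r : seq I) (P : pred I) (F G : I -> R).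

Lemma RsumE F r : Rsum F r = \sum_(i <- r) F i.
Proof. by elim: r => [|x r IH]; rewrite ?big_nil // big_cons -IH. Qed.

Lemma sumR_le r P F G :
  (forall i, P i -> F i <= G i) ->
  \big[Rplus/0]_(i <- r | P i) F i <= \big[Rplus/0]_(i <- r | P i) G i.
Proof.
move=> FG; elim: r => [|x r IH]; first by rewrite !big_nil; lra.
by rewrite !big_cons; case: ifP => // /FG; lra.
Qed.

Lemma sumR_ge0 r P F :
  (forall i, P i -> 0 <= F i) -> 0 <= \big[Rplus/0]_(i <- r | P i) F i.
Proof.
move=> F0; elim: r => [|x r IH]; first by rewrite big_nil; lra.
by rewrite big_cons; case: ifP => // /F0; lra.
Qed.

Lemma sumR_const r P (x : R) :
  \big[Rplus/0]_(i <- r | P i) x = INR (count P r) * x.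
Proof.
elim: r => [|y r IH]; first by rewrite big_nil /=; ring.
have -> : count P (y :: r) = addn (P y) (count P r) by [].
by rewrite big_cons IH plus_INR; case: (P y); rewrite /=; ring.
Qed.

End RealSums.

Lemma sumR_sub (I : finType) (A B : {set I}) (F : I -> R) :
  (forall i, 0 <= F i) -> A \subset B -> \sum_(i in A) F i <= \sum_(i in B) F i.
Proof.
move=> F0 AB; rewrite (big_setID A (A := B)) /= (setIidPr AB).
have : 0 <= \sum_(i in B :\: A) F i by apply: sumR_ge0.
lra.
Qed.

Lemma sumR_card (I : finType) (A : {set I}) (x : R) :
  \sum_(i in A) x = INR #|A| * x.
Proof. by rewrite -big_enum /= sumR_const count_predT -cardE. Qed.

Lemma RlebP x y : reflect (x <= y) (Rleb x y).
Proof. by rewrite /Rleb; case: Rle_dec => h; constructor. Qed.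

Lemma RltbP x y : reflect (x < y) (Rltb x y).
Proof. by rewrite /Rltb; case: Rlt_dec => h; constructor. Qed.

Lemma INR_gt0 k : leq 1 k -> 0 < INR k.
Proof. by case: k => // k _; apply/lt_0_INR/Nat.lt_0_succ. Qed.

Lemma INR_ge1 k : leq 1 k -> 1 <= INR k.
Proof. by case: k => // k _; rewrite S_INR; have := pos_INR k; lra. Qed.

(** * Valuations and the choice rule *)

Section Declarations.
Variable m : nat.
Implicit Types (D : decl m) (T : {set 'I_m}) (p : 'I_m -> R) (sup : 'I_m -> nat).

Lemma price_sumE p T : price_sum p T = \sum_(e in T) p e.
Proof. by rewrite /price_sum RsumE big_enum. Qed.

Lemma value_ge0 D T : 0 <= value D T.
Proof.
elim: D => [|x D IH] /=; first lra.
by case: ifP => // _; apply: Rle_trans IH (Rmax_r _ _).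
Qed.

Lemma value_ge D T x : List.In x D -> x.1 \subset T -> x.2 <= value D T.
Proof.
elim: D => [//|y D IH] /= [->|xD] xT; first by rewrite xT; apply: Rmax_l.
have := IH xD xT; case: ifP => // _ h; exact: Rle_trans h (Rmax_r _ _).
Qed.

Lemma value_attained D T :
  0 < value D T -> exists x, [/\ List.In x D, x.1 \subset T & x.2 = value D T].
Proof.
elim: D => [|y D IH] /=; first lra.
case: ifP => yT; last by move=> /IH[x [? ? ?]]; exists x; split=> //; right.
rewrite /Rmax; case: Rle_dec => _; last by exists y; split=> //; left.
by move=> /IH[x [? ? ?]]; exists x; split=> //; right.
Qed.

Lemma vmaxE D : vmax D = value D setT.
Proof. by elim: D => //= x D ->; rewrite subsetT. Qed.

Lemma vmax_ge0 D : 0 <= vmax D.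
Proof. by rewrite vmaxE; apply: value_ge0. Qed.

Lemma value_mono D (T T' : {set 'I_m}) : T \subset T' -> value D T <= value D T'.
Proof.
move=> TT'; case: (Rle_lt_dec (value D T) 0) => [h|/value_attained].
  by have := value_ge0 D T'; lra.
by case=> x [xD xT <-]; apply: value_ge (subset_trans xT TT').
Qed.

Lemma value_le_vmax D T : value D T <= vmax D.
Proof. by rewrite vmaxE; apply/value_mono/subsetT. Qed.

Lemma value_set0 k D : valid_decl k D -> value D set0 = 0.
Proof.
case=> _ [_ val]; have := value_ge0 D set0.
case: (Rle_lt_dec (value D set0) 0) => [h1 h2|/value_attained]; first lra.
by case=> x [/val[x0 _]]; rewrite subset0 (negbTE x0).
Qed.

Definition avail sup : {set 'I_m} := [set e | leq 1 (sup e)].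

Definition candidate p sup (x : {set 'I_m} * R) :=
  (x.1 \subset avail sup) && Rleb (price_sum p x.1) x.2.

Variant choose_set_spec p sup D : {set 'I_m} -> Prop :=
| ChooseNone of (forall x, List.In x D -> ~~ candidate p sup x) :
    choose_set_spec p sup D set0
| ChooseSome x of List.In x D & candidate p sup x &
    (forall y, List.In y D -> candidate p sup y -> y.2 <= x.2) :
    choose_set_spec p sup D x.1.

Lemma choose_setP p sup D : choose_set_spec p sup D (choose_set p sup D).
Proof.
rewrite /choose_set; set F := (F in foldl F).
(* The claim is generalised over the accumulator: the winner dominates both the rest of the list and
   the pair kept so far. *)
have H s acc :
    match foldl F acc s with
    | None => acc = None /\ forall y, List.In y s -> ~~ candidate p sup y
    | Some x => [/\ acc = Some x \/ (List.In x s /\ candidate p sup x),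
         forall y, List.In y s -> candidate p sup y -> y.2 <= x.2 &
         forall y, acc = Some y -> y.2 <= x.2]
    end.
  elim: s acc => [|z s IH] acc /=.
    by case: acc => // x; split=> // [|y [->]]; [left | lra].
  have FE : F acc z = if candidate p sup z then
      if acc is Some y then if Rltb y.2 z.2 then Some z else acc else Some z
      else acc by [].
  have := IH (F acc z); rewrite {}FE.
  case: (foldl _ _ _) => [x [h1 h2 h3]|[h1 h2]]; last first.
    move: h1; case Ez: (candidate p sup z).
      by case: acc => // y; case: ifP.
    by move=> ->; split=> // y [<-|/h2//]; rewrite Ez.
  case Ez: (candidate p sup z) h1 h3 => h1 h3; last first.
    split=> //; first by case: h1 => [|[]]; [left|right; split=> //; right].
    by move=> y [<-|/h2//]; rewrite Ez.
  case: acc h1 h3 => [a|] h1 h3; last first.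
    split=> //; first by right; case: h1 => [[<-]|[]]; split=> //; [left|right].
    by move=> y [<- _|/h2//]; apply: h3.
  case: RltbP h1 h3 => az h1 h3.
    split; first by right; case: h1 => [[<-]|[]]; split=> //; [left|right].
      by move=> y [<- _|/h2//]; apply: h3.
    by move=> y [<-]; have := h3 z erefl; lra.
  split=> //; first by case: h1 => [|[]]; [left|right; split=> //; right].
  by move=> y [<- _|/h2//]; have := h3 a erefl; lra.
case: (foldl _ _ _) (H D None) => [x [[//|[xD cx]] xmax _]|[_ none]].
  by constructor.
by constructor.
Qed.

Lemma choose_set_avail p sup D : choose_set p sup D \subset avail sup.
Proof. by case: choose_setP => [_|x _ /andP[]//]; rewrite sub0set. Qed.

Lemma choose_set_price p sup D :
  price_sum p (choose_set p sup D) <= value D (choose_set p sup D).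
Proof.
case: choose_setP => [_|x xD /andP[_ /RlebP px] _].
  by rewrite price_sumE big_set0; apply: value_ge0.
by apply: Rle_trans px _; apply: value_ge.
Qed.

(** A demanded set inside [T] attains the value of [T]; prices being nonnegative, it costs no more
    than [T] and is itself a candidate. *)
Lemma choose_set_ge p sup D T :
  (forall e, 0 <= p e) -> T \subset avail sup -> price_sum p T <= value D T ->
  value D T <= value D (choose_set p sup D).
Proof.
move=> p0 Tsup pT; case: (Rle_lt_dec (value D T) 0) => [h|].
  by have := value_ge0 D (choose_set p sup D); lra.
move=> /value_attained[x [xD xT xv]].
have cx : candidate p sup x.
  rewrite /candidate (subset_trans xT Tsup); apply/RlebP.
  rewrite xv; apply: Rle_trans _ pT; rewrite !price_sumE.
  exact: sumR_sub.
rewrite -xv; case: choose_setP => [/(_ x xD)|y yD _ /(_ x xD cx)].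
  by rewrite cx.
by move=> h; apply: Rle_trans h _; apply: value_ge.
Qed.

End Declarations.

(** * The top bidder and the tie-breaking rule *)

Section TopBidder.
Variables (m n : nat).
Implicit Type bids : 'I_n -> decl m.

Lemma top_bidderP bids :
  match top_bidder bids with
  | None => forall i : 'I_n, False
  | Some j => forall i, vmax (bids i) <= vmax (bids j) /\
      (leq i.+1 j -> vmax (bids i) < vmax (bids j))
  end.
Proof.
rewrite /top_bidder; set F := (F in foldl F).
(* The enumeration is increasing, so keeping the earlier bidder on ties selects the smallest
   index. *)
have srt : pairwise (fun x y : 'I_n => ltn x y) (enum 'I_n).
  have := iota_ltn_sorted 0 n; rewrite -val_enum_ord sorted_pairwise; last first.
    exact: ltn_trans.
  by rewrite pairwise_map.
suff : match foldl F None (enum 'I_n) with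
  | None => forall i : 'I_n, i \in enum 'I_n -> False
  | Some j => j \in enum 'I_n /\
      forall i, i \in enum 'I_n -> vmax (bids i) <= vmax (bids j) /\
        (leq i.+1 j -> vmax (bids i) < vmax (bids j))
  end.
  by case: foldl => [j [_ H] i|H i]; apply: (H i); rewrite mem_enum.
elim/last_ind: (enum 'I_n) srt => [//|s x IH].
rewrite pairwise_rcons foldl_rcons => /andP[/allP sx /IH{IH}].
case: (foldl _ _ _) => [j [js H]|H] /=; last first.
  split=> [|i]; rewrite mem_rcons inE ?eqxx // => /orP[/eqP->|/H//].
  by rewrite ltnn; split=> //; lra.
case: RltbP => jx; split=> [|i]; rewrite mem_rcons inE ?eqxx ?js ?orbT //.
  case/orP=> [/eqP->|/H]; first by rewrite ltnn; split=> //; lra.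
  by case=> h _; split=> [|_]; lra.
case/orP=> [/eqP->|/H//]; split; first lra.
by have := sx _ js; rewrite /= => /ltnW; rewrite leqNgt => /negbTE ->.
Qed.

Lemma top_bidder_max bids j i :
  top_bidder bids = Some j -> vmax (bids i) <= vmax (bids j).
Proof. by move=> topj; have := top_bidderP bids; rewrite topj => /(_ i)[]. Qed.

Lemma top_bidder_first bids j (i : 'I_n) :
  top_bidder bids = Some j -> leq i.+1 j -> vmax (bids i) < vmax (bids j).
Proof. by move=> topj; have := top_bidderP bids; rewrite topj => /(_ i)[]. Qed.

Lemma top_bidder_exists bids (i : 'I_n) : exists j, top_bidder bids = Some j.
Proof. by have := top_bidderP bids; case: top_bidder => [j _|/(_ i)//]; exists j. Qed.

Lemma upd_same (A : Type) (f : 'I_n -> A) i x : upd f i x i = x.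
Proof. by rewrite /upd eqxx. Qed.

Lemma upd_other (A : Type) (f : 'I_n -> A) i x j : j != i -> upd f i x j = f j.
Proof. by rewrite /upd => /negbTE ->. Qed.

(** Another winner [j] would force [D], [D'] and the declaration of [j] to have equal maxima, and
    then the index order contradicts one of the two selections. *)
Lemma top_bidder_raise bids i (D D' : decl m) : vmax D <= vmax D' ->
  top_bidder (upd bids i D) = Some i -> top_bidder (upd bids i D') = Some i.
Proof.
move=> DD' topi; have [j topj] := top_bidder_exists (upd bids i D') i.
have [ij|ji] := eqVneq j i; first by rewrite topj ij.
have := top_bidder_max j topi; have := top_bidder_max i topj.
have := top_bidder_first (i := j) topi; have := top_bidder_first (i := i) topj.
rewrite !upd_same !upd_other //.
case: (ltngtP i j) => [_|_|/val_inj ij]; last by case/eqP: ji.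
- by move=> /(_ isT); lra.
- by move=> _ /(_ isT); lra.
Qed.

(** Both winners declare the same in the two profiles, so their maxima are equal and the common
    tie-breaking rule identifies them. *)
Lemma top_bidder_upd bids i j j' (D D' : decl m) :
  top_bidder (upd bids i D) = Some j -> top_bidder (upd bids i D') = Some j' ->
  j != i -> j' != i -> j = j'.
Proof.
move=> topj topj' ji j'i.
have := top_bidder_max j' topj; have := top_bidder_max j topj'.
have := top_bidder_first (i := j') topj; have := top_bidder_first (i := j) topj'.
rewrite !upd_other //; case: (ltngtP j j') => [_|_|/val_inj //].
- by move=> /(_ isT); lra.
- by move=> _ /(_ isT); lra.
Qed.

End TopBidder.

(** * Invariants of the sequential run *)

Section Process.
Variables (m n : nat) (r : R) (j : 'I_n).
Implicit Types (bids : 'I_n -> decl m) (c : 'I_n -> bool) (st : state m n).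

Lemma eq_foldl_step c c' bids bids' s st :
  (forall i, i \in s -> c i = c' i /\ bids i = bids' i) ->
  foldl (step r j c bids) st s = foldl (step r j c' bids') st s.
Proof.
elim: s st => [//|i s IH] st /= H.
rewrite IH => [|k ks]; last by apply: H; rewrite inE ks orbT.
by rewrite /step; have [-> ->] : c i = c' i /\ bids i = bids' i
  by apply: H; rewrite mem_head.
Qed.

Lemma alloc_foldl_step c bids s st i : i \notin s ->
  alloc (foldl (step r j c bids) st s) i = alloc st i.
Proof.
elim: s st => [//|k s IH] st; rewrite inE negb_or => /andP[/negbTE ik /IH].
by rewrite /= => ->; rewrite /= ik.
Qed.

Lemma prices_foldl_step_ge0 c bids s st : 0 <= r ->
  (forall e, 0 <= prices st e) ->
  forall e, 0 <= prices (foldl (step r j c bids) st s) e.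
Proof.
move=> r0; elim: s st => [//|i s IH] st /= H; apply: IH => e /=.
by case: ifP => _ //; apply: Rmult_le_pos.
Qed.

(** The invariant adds the copies of a good already given out to its remaining supply. It is an
    inequality because processing a bidder again overwrites his earlier set. *)
Lemma feasible_foldl_step c bids b s st :
  (forall e, leq (addn #|[set i | e \in alloc st i]| (supply st e)) b) ->
  feasible b (alloc (foldl (step r j c bids) st s)).
Proof.
elim: s st => [|i s IH] st /= H.
  by move=> e; apply: leq_trans (H e); apply: leq_addr.
apply: IH => e /=; set S := choose_set _ _ _.
set Ri := if _ then S else set0.
case: ifP => eR.
  (* The chosen set is available, so the predecessor in the supply update is a true decrement. *)
  have : leq 1 (supply st e).
    have : e \in S by move: eR; rewrite /Ri; case: ifP; rewrite ?inE.
    by move/(subsetP (choose_set_avail _ _ _)); rewrite inE.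
  move: (H e); case: (supply st e) => // k; rewrite addnS -addSn => h _ /=.
  apply: leq_trans h; rewrite leq_add2r.
  apply: leq_trans (_ : leq #|i |: [set i0 | e \in alloc st i0]| _).
    apply/subset_leq_card/subsetP => i0; rewrite !inE.
    by case: eqVneq => // _; rewrite eqxx.
  by rewrite cardsU1; case: (_ \notin _).
apply: leq_trans (H e); rewrite leq_add2r; apply/subset_leq_card/subsetP => i0.
by rewrite !inE; case: eqVneq => // _; rewrite eR.
Qed.

End Process.

(** * Truthfulness and feasibility for fixed coins *)

Section Mechanism.
Variables (m n b : nat) (eps : R).
Hypotheses (b_gt0 : leq 1 b) (eps01 : 0 < eps < 1).
Implicit Types (bids : 'I_n -> decl m) (c : 'I_n -> bool).

Definition others (j : 'I_n) := [seq i <- enum 'I_n | i != j].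

Definition base_price (V : R) : R := (1 + eps) * V / (4 * INR b * INR m).

Definition init_state (p : R) : state m n :=
  St (fun _ => p) (fun _ => b) (fun _ => set0).

Lemma mechE c bids j : top_bidder bids = Some j ->
  mech m n b eps c bids =
  alloc (foldl (step (Rpower 2 (/ INR b)) j c bids)
    (init_state (base_price (vmax (bids j)))) (j :: others j)).
Proof. by rewrite /mech => ->. Qed.

Lemma mem_others j i : (i \in others j) = (i != j).
Proof. by rewrite mem_filter mem_enum andbT. Qed.

Lemma uniq_others j : uniq (others j).
Proof. by rewrite filter_uniq // enum_uniq. Qed.

Lemma mech_top c bids j : top_bidder bids = Some j ->
  mech m n b eps c bids j =
  choose_set (fun _ => base_price (vmax (bids j))) (fun _ => b) (bids j).
Proof.
move=> topj; rewrite (mechE _ topj) /= alloc_foldl_step ?mem_others ?eqxx //=.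
by rewrite eqxx.
Qed.

Definition state_before c bids j i : state m n :=
  foldl (step (Rpower 2 (/ INR b)) j c bids)
    (init_state (base_price (vmax (bids j))))
    (take (index i (j :: others j)) (j :: others j)).

Lemma mech_other c bids j i : top_bidder bids = Some j -> i != j ->
  mech m n b eps c bids i =
  if c i then choose_set (prices (state_before c bids j i))
                (supply (state_before c bids j i)) (bids i)
  else set0.
Proof.
move=> topj ij; rewrite (mechE _ topj) /state_before.
have uo : uniq (j :: others j) by rewrite /= mem_others eqxx uniq_others.
have io : i \in j :: others j by rewrite inE mem_others ij orbT.
(* The order is cut at [i], who does not occur again, so later steps leave his set unchanged. *)
rewrite -{1}(cat_take_drop (index i (j :: others j)) (j :: others j)).
rewrite (drop_nth j) ?index_mem // nth_index // foldl_cat /=.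
rewrite alloc_foldl_step /= ?eqxx ?(negbTE ij) //.
move: uo; rewrite -{1}(cat_take_drop (index i (j :: others j)) (j :: others j)).
rewrite (drop_nth j) ?index_mem // nth_index // cat_uniq.
by case/and3P => _ _ /= /andP[].
Qed.

Lemma base_price_ge0 V : leq 1 m -> 0 <= V -> 0 <= base_price V.
Proof.
move=> m_gt0 V0; have := INR_gt0 b_gt0; have := INR_gt0 m_gt0 => hm hb.
apply: Rmult_le_pos; first by apply: Rmult_le_pos; lra.
by apply/Rlt_le/Rinv_0_lt_compat; apply: Rmult_lt_0_compat; lra.
Qed.

Lemma base_price_sum V : leq 1 m ->
  INR b * (INR m * base_price V) = (1 + eps) * V / 4.
Proof.
move=> m_gt0; have := INR_gt0 b_gt0; have := INR_gt0 m_gt0 => hm hb.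
by rewrite /base_price; field; lra.
Qed.

Lemma base_price_sum_le V : leq 1 m -> 0 <= V ->
  INR b * (INR m * base_price V) <= V / 2.
Proof. by move=> m_gt0 V0; rewrite base_price_sum //; nra. Qed.

(** At base prices the set of all goods costs at most half of the maximal value, so it can serve as
    the competitor in [choose_set_ge]. *)
Lemma choose_set_top (D : decl m) : leq 1 m ->
  value D (choose_set (fun _ => base_price (vmax D)) (fun _ => b) D) = vmax D.
Proof.
move=> m_gt0; apply: Rle_antisym; first exact: value_le_vmax.
have V0 := vmax_ge0 D; have p0 := base_price_ge0 m_gt0 V0.
rewrite {1}vmaxE; apply: choose_set_ge => //.
  by apply/subsetP => e _; rewrite inE.
rewrite -vmaxE price_sumE.
have -> : \sum_(e in [set: 'I_m]) base_price (vmax D) = INR m * base_price (vmax D).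
  by rewrite sumR_card cardsT card_ord.
have := base_price_sum_le m_gt0 V0; have := INR_ge1 b_gt0; have := INR_gt0 m_gt0.
have := Rmult_le_pos _ _ (pos_INR m) p0; nra.
Qed.

Lemma Rpower2_gt0 : 0 < Rpower 2 (/ INR b).
Proof. exact: exp_pos. Qed.

Lemma mech_truthful k c : truthful_verif k (mech m n b eps c).
Proof.
move=> bids i t z others_valid valid_t valid_z.
set T := mech _ _ _ _ _ (upd bids i z) i => verif.
(* If the lie wins nothing the claim is immediate; otherwise a good of [T] shows that [m] is
   positive. *)
have [T0|/set0Pn[e0 _]] := eqVneq T set0.
  by rewrite T0 (value_set0 valid_t); apply: value_ge0.
have m_gt0 : leq 1 m by case: (m) e0 => // [[]].
have [j topj] := top_bidder_exists (upd bids i z) i.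
have [j' topj'] := top_bidder_exists (upd bids i t) i.
have truth_top : top_bidder (upd bids i t) = Some i ->
    value t T <= value t (mech m n b eps c (upd bids i t) i).
  by move=> topi; rewrite (mech_top _ topi) upd_same choose_set_top //;
    apply: value_le_vmax.
have [j'i|j'i] := eqVneq j' i; first by apply: truth_top; rewrite topj' j'i.
have [ji|ji] := eqVneq j i.
  (* A lie that makes [i] top wins a set of declared value [vmax z]; verification bounds this by
     [vmax t], so the truth makes [i] top as well. *)
  apply/truth_top/(top_bidder_raise (D := z)); last by rewrite topj ji.
  apply: Rle_trans (value_le_vmax t T); apply: Rle_trans verif.
  rewrite ji in topj; rewrite /T (mech_top _ topj) upd_same choose_set_top //; lra.
(* Otherwise the top bidder, hence the base price, is the same in both profiles, and [i] meets the
   same prices and supplies. *)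
have jj' := top_bidder_upd topj topj' ji j'i; rewrite -{}jj' in topj' => {j'i}.
have ij : i != j by rewrite eq_sym.
move: verif => {truth_top}; rewrite {}/T (mech_other _ topj ij) (mech_other _ topj' ij).
have -> : state_before c (upd bids i t) j i = state_before c (upd bids i z) j i.
  rewrite /state_before !(upd_other _ _ ji); apply: eq_foldl_step => i' Hi'.
  have i'i : i' != i; last by rewrite !upd_other.
  apply: contraTneq Hi' => ->; by rewrite in_take ?ltnn // inE mem_others ij orbT.
set st := state_before c _ _ _.
case: (c i) => verif; last by rewrite (value_set0 valid_t); lra.
move: verif; rewrite !upd_same; set T := choose_set _ _ z => verif.
(* The set won by the lie costs at most its declared value, hence at most its true value. *)
apply: choose_set_ge; last by apply: Rle_trans verif; apply: choose_set_price.
  apply: prices_foldl_step_ge0 => [|e]; first exact/Rlt_le/Rpower2_gt0.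
  exact/base_price_ge0/vmax_ge0.
exact: choose_set_avail.
Qed.

Lemma mech_feasible c bids : feasible b (mech m n b eps c bids).
Proof.
rewrite /mech; case: top_bidder => [j|e]; last first.
  by rewrite (_ : [set i | _] = set0) ?cards0 //; apply/setP => i; rewrite !inE.
apply: feasible_foldl_step => e /=.
by rewrite (_ : [set i | _] = set0) ?cards0 //; apply/setP => i; rewrite !inE.
Qed.

End Mechanism.

(** * Expectation over independent coins *)

Section Coins.
Variables (n : nat) (q : R).
Local Notation coins := {ffun 'I_n -> bool}.
Implicit Types (c : coins) (f g : coins -> R).

Definition expect f : R := \sum_(c : coins) coin_weight q c * f c.

Lemma coin_weightE c :
  coin_weight q c = \big[Rmult/1]_i (if c i then q else 1 - q).
Proof.
rewrite /coin_weight -big_enum /=.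
by elim: (enum 'I_n) => [|i s IH]; rewrite ?big_nil // big_cons -IH.
Qed.

Lemma eq_expect f g : f =1 g -> expect f = expect g.
Proof. by move=> fg; apply: eq_bigr => c _; rewrite fg. Qed.

Lemma expectD f g : expect (fun c => f c + g c) = expect f + expect g.
Proof.
by rewrite /expect -big_split; apply: eq_bigr => c _; rewrite /=; ring.
Qed.

Lemma expectZ a f : expect (fun c => a * f c) = a * expect f.
Proof.
by rewrite /expect big_distrr /=; apply: eq_bigr => c _; rewrite /=; ring.
Qed.

Lemma expect_const a : expect (fun=> a) = a.
Proof.
rewrite /expect -big_distrl /=.
suff -> : \sum_(c : coins) coin_weight q c = 1 by apply: Rmult_1_l.
under eq_bigr => c _ do rewrite coin_weightE.
(* Distributivity turns the sum over all outcomes into a product over bidders of the factor q + (1 -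
   q). *)
rewrite -(bigA_distr_bigA (fun (i : 'I_n) (x : bool) => if x then q else 1 - q)).
rewrite big1 // => i _; rewrite big_bool /=; ring.
Qed.

Definition set_coin c i x : coins := [ffun k => if k == i then x else c k].

(* Pairing c with its flip at i makes both sides equal term by term, at the
   price of counting every outcome twice. *)
Lemma expect_resample i f :
  expect f = expect (fun c => q * f (set_coin c i true)
                              + (1 - q) * f (set_coin c i false)).
Proof.
pose flip c := set_coin c i (~~ c i).
have flipK : involutive flip.
  by move=> c; apply/ffunP => k; rewrite !ffunE eqxx negbK; case: eqVneq => // ->.
have dup g : 2 * expect g =
    \sum_(c : coins) (coin_weight q c * g c + coin_weight q (flip c) * g (flip c)).
  rewrite big_split /= -/(expect g); set Y := (Y in _ = _ + Y).
  suff -> : Y = expect g by ring.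
  by rewrite /expect (reindex_inj (inv_inj flipK)).
apply: (Rmult_eq_reg_l 2); last lra; rewrite !dup; apply: eq_bigr => c _.
have setK x : set_coin (flip c) i x = set_coin c i x.
  by apply/ffunP => k; rewrite !ffunE; case: eqVneq.
have setci : set_coin c i (c i) = c.
  by apply/ffunP => k; rewrite !ffunE; case: eqVneq => // ->.
have wE x : coin_weight q (set_coin c i x) = (if x then q else 1 - q) *
    \big[Rmult/1]_(k | k != i) (if c k then q else 1 - q).
  rewrite coin_weightE (bigD1 i) //= ffunE eqxx; congr (_ * _).
  by apply: eq_bigr => k /negbTE ki; rewrite ffunE ki.
have fc : f c = f (set_coin c i (c i)) by rewrite setci.
have := wE (c i); rewrite setci !setK /flip fc wE => ->.
by case: (c i) => /=; ring.
Qed.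

End Coins.

(** * Numerical estimates for the potential *)

Section Estimates.

(** Amounts to exp (3/5) <= 2: the inequality exp x >= 1 + x at x = -1/5, cubed, gives exp (-3/5) >=
    64/125 > 1/2. *)
Lemma ln2_ge : 3 / 5 <= ln 2.
Proof.
have h : 4 / 5 <= exp (- (1 / 5)) by have := exp_ineq1_le (- (1 / 5)); lra.
have e3 : exp (- (3 / 5)) = exp (- (1 / 5)) ^ 3.
  by rewrite /= Rmult_1_r -!exp_plus; congr exp; lra.
have e35 : exp (3 / 5) * exp (- (3 / 5)) = 1.
  by rewrite -exp_plus -exp_0; congr exp; lra.
have p35 := exp_pos (3 / 5).
have : (4 / 5) ^ 3 <= exp (- (3 / 5)) by rewrite e3; apply: pow_incr; lra.
rewrite /= => h3; have le2 : exp (3 / 5) <= 2 by nra.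
rewrite -(ln_exp (3 / 5)); case: le2 => [lt2|->]; last lra.
by apply/Rlt_le/ln_increasing.
Qed.

Lemma ln2_le1 : ln 2 <= 1.
Proof.
rewrite -(ln_exp 1); have [lt2|<-] : 2 <= exp 1 by have := exp_ineq1_le 1; lra.
  by apply/Rlt_le/ln_increasing; lra.
lra.
Qed.

Lemma one_plus_div_pow_le k y : leq 1 k -> 0 <= y -> (1 + y / INR k) ^ k <= exp y.
Proof.
move=> k_gt0 y0; have kp := INR_gt0 k_gt0.
have powE x : exp x ^ k = exp (INR k * x).
  elim: k {k_gt0 kp} => [|k IH]; first by rewrite /= Rmult_0_l exp_0.
  by rewrite S_INR -tech_pow_Rmult IH -exp_plus; congr exp; ring.
have -> : exp y = exp (y / INR k) ^ k by rewrite powE; congr exp; field; lra.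
apply: pow_incr; split; last exact: exp_ineq1_le.
by have := Rle_mult_inv_pos _ _ y0 kp; rewrite /Rdiv; lra.
Qed.

(** A Stirling-type bound, k! >= e (k/e)^k; the induction step is (1 + 1/k)^k <= e. *)
Lemma fact_ge k : leq 1 k -> INR k ^ k * exp 1 <= INR (fact k) * exp 1 ^ k.
Proof.
case: k => // k _; elim: k => [|k IH]; first by rewrite /=; lra.
have kp : 0 < INR k.+1 by apply: INR_gt0.
have ep := exp_pos 1.
have h : INR k.+2 ^ k.+1 <= INR k.+1 ^ k.+1 * exp 1.
  have -> : INR k.+2 = INR k.+1 * (1 + 1 / INR k.+1).
    by rewrite (S_INR k.+1); field; lra.
  rewrite Rpow_mult_distr; apply: Rmult_le_compat_l; first by apply: pow_le; lra.
  by apply: one_plus_div_pow_le => //; lra.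
rewrite -(tech_pow_Rmult _ k.+1) -(tech_pow_Rmult (exp 1) k.+1).
have -> : INR (fact k.+2) = INR k.+2 * INR (fact k.+1) by rewrite -mult_INR.
have kp2 : 0 < INR k.+2 by apply: INR_gt0.
apply: Rle_trans (_ : INR k.+2 * exp 1 * (INR k.+1 ^ k.+1 * exp 1) <= _).
  have := Rmult_le_compat_l (INR k.+2 * exp 1) _ _ _ h; nra.
have := Rmult_le_compat_l (INR k.+2 * exp 1) _ _ _ IH; nra.
Qed.

(** Keeps two terms of the binomial expansion of the right-hand side, as [potential_step]
    requires. *)
Lemma pow_succ_ge s y : 0 <= y -> y ^ s.+1 + INR s.+1 * y ^ s <= (y + 1) ^ s.+1.
Proof.
move=> y0; elim: s => [|s IH]; first by rewrite /=; lra.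
rewrite -(tech_pow_Rmult (y + 1) s.+1) (S_INR s.+1).
have := Rmult_le_compat_l (y + 1) _ _ _ IH.
have := pow_le y s y0; have := pos_INR s.+1; rewrite -!tech_pow_Rmult.
set u := y ^ s; set k := INR _ => k0 u0 /(_ ltac:(lra)).
have := Rmult_le_pos _ _ k0 u0; nra.
Qed.

Lemma mul_pow_le k : INR k * (5 / 6) ^ k <= 5.
Proof.
(* Bernoulli's inequality gives (6/5)^k >= 1 + k/5. *)
have h := poly k (1 / 5) ltac:(lra).
have e1 : (1 + 1 / 5) ^ k * (5 / 6) ^ k = 1.
  by rewrite -Rpow_mult_distr (_ : _ * _ = 1) ?pow1 //; field.
have p := pow_lt (5 / 6) k ltac:(lra).
nra.
Qed.

(** Bernoulli's inequality applied to 2 = r^b. Raising the prices of a set thus costs at most its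
    price, even when each good is counted [b] times. *)
Lemma Rpower_2_inv_le b : leq 1 b -> INR b * (Rpower 2 (/ INR b) - 1) <= 1.
Proof.
move=> b_gt0; have bp := INR_gt0 b_gt0; set r := Rpower 2 _.
have r1 : 1 < r.
  rewrite -(Rpower_O 2); last lra.
  by apply: Rpower_lt; [lra | apply: Rinv_0_lt_compat].
have rb : r ^ b = 2.
  rewrite -Rpower_pow ?Rpower_mult; last lra.
  by rewrite Rinv_l ?Rpower_1; lra.
have := poly b (r - 1) ltac:(lra); rewrite (_ : 1 + (r - 1) = r) ?rb; lra.
Qed.

Variables (m b d : nat).
Hypotheses (m_gt0 : leq 1 m) (b_gt0 : leq 1 b) (d_gt0 : leq 1 d).

Let D := Rpower (INR d) (/ INR b).
Let L := ln (4 * INR b * INR m).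
Let q := qprob b m d.

Lemma Rpower_inv_pow : D ^ b = INR d.
Proof.
have bp := INR_gt0 b_gt0; have dp := INR_gt0 d_gt0.
rewrite -Rpower_pow ?Rpower_mult; last exact: exp_pos.
by rewrite Rinv_l ?Rpower_1; lra.
Qed.

Lemma Rpower_inv_ge1 : 1 <= D.
Proof.
have bp := INR_gt0 b_gt0; have dp := INR_ge1 d_gt0.
rewrite -(Rpower_O (INR d)); last lra.
by apply: Rle_Rpower => //; apply/Rlt_le/Rinv_0_lt_compat.
Qed.

Lemma ln_4bm : L = 2 * ln 2 + ln (INR b * INR m).
Proof.
have bp := INR_gt0 b_gt0; have mp := INR_gt0 m_gt0.
rewrite /L (_ : 4 * INR b * INR m = 2 * (2 * (INR b * INR m))); last ring.
have bm := Rmult_lt_0_compat _ _ bp mp.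
by rewrite !ln_mult; lra.
Qed.

Lemma ln_bm_ge0 : 0 <= ln (INR b * INR m).
Proof.
have bp := INR_ge1 b_gt0; have mp := INR_ge1 m_gt0.
have : 1 <= INR b * INR m by nra.
by rewrite -ln_1 => -[lt1|<-]; [apply/Rlt_le/ln_increasing; lra | lra].
Qed.

Lemma ln_4bm_ge : 2 * ln 2 <= L.
Proof. by rewrite ln_4bm; have := ln_bm_ge0; lra. Qed.

Lemma qprobE : q = / (2 * exp 1 * D * L).
Proof. by []. Qed.

Lemma qprob_gt0 : 0 < q.
Proof.
have := ln_4bm_ge; have := ln2_ge; have := Rpower_inv_ge1 => D1 l2 lL.
rewrite qprobE; apply: Rinv_0_lt_compat.
by do 2![apply: Rmult_lt_0_compat; try lra]; have := exp_pos 1; lra.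
Qed.

(** The factor 12 is 2 * 3 * 2, from e <= 3 and 2 ln 2 + l <= 2 (1 + l). *)
Lemma inv_qprob_le : / q <= 12 * (D * (1 + ln (INR b * INR m))).
Proof.
rewrite qprobE Rinv_inv ln_4bm; have := ln_bm_ge0; have := ln2_le1.
have := exp_le_3; have := exp_pos 1; have := Rpower_inv_ge1; have := ln2_ge.
set l := ln (_ * _) => l2 D1 e0 e3 l2' l0.
apply: Rle_trans (_ : 2 * 3 * D * (2 * ln 2 + l) <= _).
  by apply: Rmult_le_compat_r; first lra; apply: Rmult_le_compat_r; lra.
rewrite (_ : 12 * _ = 2 * 3 * D * (2 * (1 + l))); last ring.
by apply: Rmult_le_compat_l; lra.
Qed.

Lemma qprob_le1 : q <= 1.
Proof.
have := ln_4bm_ge; have := ln2_ge; have := Rpower_inv_ge1; have := exp_ineq1_le 1.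
move=> e2 D1 l2 lL; rewrite qprobE -[X in _ <= X]Rinv_1.
apply: Rinv_le_contravar; first lra.
have : 1 <= exp 1 * D by nra.
set x := exp 1 * D => x1; have -> : 2 * exp 1 * D * L = 2 * (x * L) by rewrite /x; ring.
have := Rmult_le_compat_r L _ _ _ x1; lra.
Qed.

(** The number of requests for a good that starts at price V / (4bm), where V is the top value: each
    request multiplies the price by 2^(1/b). *)
Definition max_requests := 1 + INR b * (L / ln 2).

Let a := max_requests * q.

(** Uses 1 / ln 2 <= 5/3 and 1 / L <= 1 / (2 ln 2). The form suits b-th powers: 5/6 yields a
    geometric decay, and the power of the last factor stays below exp (1/2). *)
Lemma requests_le : a <= INR b / (exp 1 * D) * (5 / 6) * (1 + (1 / 2) / INR b).
Proof.
have bp := INR_gt0 b_gt0; have := Rpower_inv_ge1; have := ln2_ge; have := ln_4bm_ge.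
have e0 := exp_pos 1 => lL l2 D1.
have -> : a = / (exp 1 * D) * (/ L + INR b / ln 2) / 2.
  by rewrite /a /max_requests qprobE; field; repeat split; lra.
have -> : INR b / (exp 1 * D) * (5 / 6) * (1 + 1 / 2 / INR b) =
  / (exp 1 * D) * ((5 / 3) * (1 / 2 + INR b)) / 2 by field; repeat split; lra.
have eD : 0 < / (exp 1 * D) by apply/Rinv_0_lt_compat/Rmult_lt_0_compat; lra.
apply: Rmult_le_compat_r; first lra; apply: Rmult_le_compat_l; first lra.
have i2 : / ln 2 <= 5 / 3.
  by rewrite (_ : 5 / 3 = / (3 / 5)); [apply: Rinv_le_contravar; lra | field].
have iL : / L <= / ln 2 / 2.
  rewrite (_ : / ln 2 / 2 = / (2 * ln 2)); first by apply: Rinv_le_contravar; lra.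
  by field; lra.
have := Rmult_le_compat_l (INR b) _ _ _ i2; rewrite /Rdiv; lra.
Qed.

Lemma requests_ge : INR b / (2 * exp 1 * D) <= a.
Proof.
have bp := INR_gt0 b_gt0; have := Rpower_inv_ge1; have := ln2_ge; have := ln_4bm_ge.
have e0 := exp_pos 1; have := ln2_le1 => l1 lL l2 D1.
have -> : a = / (2 * exp 1 * D) * (/ L + INR b / ln 2).
  by rewrite /a /max_requests qprobE; field; repeat split; lra.
rewrite /Rdiv Rmult_comm; apply: Rmult_le_compat_l.
  by apply/Rlt_le/Rinv_0_lt_compat/Rmult_lt_0_compat; lra.
have iL : 0 < / L by apply: Rinv_0_lt_compat; lra.
have i2 : 1 <= / ln 2 by rewrite -Rinv_1; apply: Rinv_le_contravar; lra.
nra.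
Qed.

(** In the b-th power of [requests_le], D^b is d, b^b / (e^b b!) is at most 1/e by [fact_ge], and
    the last factor contributes at most e^(1/2); finally e^(-1/2) <= 2/3. *)
Lemma requests_pow_le : a ^ b / INR (fact b) <= 2 / 3 * (5 / 6) ^ b / INR d.
Proof.
have bp := INR_gt0 b_gt0; have D1 := Rpower_inv_ge1; have e0 := exp_pos 1.
have a0 : 0 <= a.
  apply: Rle_trans requests_ge; apply: Rle_mult_inv_pos; first lra.
  by apply: Rmult_lt_0_compat; lra.
have fp : 0 < INR (fact b) by apply: INR_fact_lt_0.
have dp := INR_gt0 d_gt0.
have h : a ^ b <= INR b ^ b * / (exp 1 ^ b * INR d) * (5 / 6) ^ b
                  * (1 + (1 / 2) / INR b) ^ b.
  rewrite -Rpower_inv_pow -Rpow_mult_distr -pow_inv -!Rpow_mult_distr.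
  exact: pow_incr (conj a0 requests_le).
have h1 := @one_plus_div_pow_le b (1 / 2) b_gt0 ltac:(lra).
have h2 := fact_ge b_gt0.
have e12 : exp 1 = exp (1 / 2) * exp (1 / 2) by rewrite -exp_plus; congr exp; lra.
have e12' : 3 / 2 <= exp (1 / 2) by have := exp_ineq1_le (1 / 2); lra.
have p56 := pow_lt (5 / 6) b ltac:(lra).
have ebp := pow_lt (exp 1) b e0.
have ip : 0 < / INR (fact b) by apply: Rinv_0_lt_compat.
set B := INR b ^ b in h h2; set Eb := exp 1 ^ b in h h2 ebp.
have h3 : B * / Eb * / INR (fact b) <= / exp 1.
  apply: (Rmult_le_reg_r (exp 1)) => //; apply: (Rmult_le_reg_r (Eb * INR (fact b))).
    exact: Rmult_lt_0_compat.
  rewrite (_ : _ * _ = B * exp 1); last by field; lra.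
  by rewrite (_ : _ * (_ * _) = INR (fact b) * Eb); last by field; lra.
apply: Rle_trans (Rmult_le_compat_r (/ INR (fact b)) _ _ _ h) _; first lra.
set P := (5 / 6) ^ b in h p56 *; set Q := (1 + _) ^ b in h h1 *.
have Q0 : 0 <= Q.
  by apply: pow_le; have := Rle_mult_inv_pos _ _ (_ : 0 <= 1 / 2) bp; rewrite /Rdiv; lra.
rewrite (_ : _ * _ = (B * / Eb * / INR (fact b)) * Q * (P * / INR d)); last first.
  by field; lra.
rewrite (_ : 2 / 3 * P / INR d = 2 / 3 * (P * / INR d)); last by field; lra.
apply: Rmult_le_compat_r.
  by apply/Rlt_le/Rmult_lt_0_compat => //; apply: Rinv_0_lt_compat.
apply: Rle_trans (_ : / exp 1 * exp (1 / 2) <= _).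
  apply: Rmult_le_compat => //; apply: Rmult_le_pos; last lra.
  by apply: Rle_mult_inv_pos => //; apply: pow_le; lra.
rewrite e12 (_ : / _ * _ = / exp (1 / 2)); last by field; lra.
by rewrite (_ : 2 / 3 = / (3 / 2)); [apply: Rinv_le_contravar; lra | field].
Qed.

(** Of the decay (5/6)^b only one factor 5/6 is kept. A set of d goods then has total potential at
    most 5/9, below 1. *)
Lemma requests_pow_le_supply : a ^ b / INR (fact b) <= 5 / 9 / INR d.
Proof.
apply: Rle_trans requests_pow_le _; have dp := INR_gt0 d_gt0.
apply: Rmult_le_compat_r; first by apply/Rlt_le/Rinv_0_lt_compat.
have : (5 / 6) ^ b <= 5 / 6.
  case: (b) b_gt0 => // k _; rewrite -tech_pow_Rmult.
  have := pow_incr (5 / 6) 1 k ltac:(lra); rewrite pow1; lra.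
lra.
Qed.

Lemma pow_fact_pred x k : leq 1 k ->
  x ^ k.-1 / INR (fact k.-1) * x = INR k * (x ^ k / INR (fact k)).
Proof.
case: k => // k _; rewrite -tech_pow_Rmult [k.+1.-1]/=.
have -> : INR (fact k.+1) = INR k.+1 * INR (fact k) by rewrite -mult_INR.
have := INR_fact_lt_0 k; have := @INR_gt0 k.+1 isT => h1 h2; field; lra.
Qed.

(** Multiplying by [a] raises the exponent to b at the cost of a factor b, which (5/6)^b absorbs;
    then b <= 2 e D a removes [a] again, and 2 e (10/3) <= 20. *)
Lemma requests_pow_pred_le :
  a ^ b.-1 / INR (fact b.-1) * (INR b * INR d) <= 20 * D.
Proof.
have D1 := Rpower_inv_ge1; have e0 := exp_pos 1; have e3 := exp_le_3.
have dp := INR_gt0 d_gt0; have bp := INR_gt0 b_gt0.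
have eD : 0 < 2 * exp 1 * D by apply: Rmult_lt_0_compat; lra.
have ba : INR b <= 2 * exp 1 * D * a.
  apply: (Rmult_le_reg_r (/ (2 * exp 1 * D))); first exact: Rinv_0_lt_compat.
  by have := requests_ge; rewrite (_ : _ * a * _ = a) //; field; lra.
have a0 : 0 <= a by nra.
set c := a ^ b.-1 / _; have c0 : 0 <= c.
  by apply: Rle_mult_inv_pos; [apply: pow_le | apply: INR_fact_lt_0].
have ca : c * a = INR b * (a ^ b / INR (fact b)) := pow_fact_pred a b_gt0.
have cad : c * a * INR d <= 10 / 3.
  rewrite ca; have := mul_pow_le b => h.
  apply: Rle_trans (_ : INR b * (2 / 3 * (5 / 6) ^ b / INR d) * INR d <= _).
    apply: Rmult_le_compat_r; first lra.
    by apply: Rmult_le_compat_l; [lra | apply: requests_pow_le].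
  rewrite (_ : _ * _ = 2 / 3 * (INR b * (5 / 6) ^ b)); first lra.
  by field; lra.
apply: Rle_trans (_ : 2 * exp 1 * D * (c * a * INR d) <= _).
  have := Rmult_le_compat_l (c * INR d) _ _ _ ba.
  have := Rmult_le_pos _ _ c0 (Rlt_le _ _ dp); nra.
apply: Rle_trans (Rmult_le_compat_l _ _ _ _ cad) _; first lra.
nra.
Qed.

End Estimates.

(** * Expected welfare of the bidders after the top one *)

Section ExpectedRun.
Variables (m n b k : nat) (t : 'I_n -> decl m) (j : 'I_n) (q : R).
Hypotheses (b_gt0 : leq 1 b) (t_valid : forall i, valid_decl k (t i)).
Hypotheses (q01 : 0 <= q <= 1).
Implicit Types (st : state m n) (s : seq 'I_n).

Let r := Rpower 2 (/ INR b).

Definition coin_step (x : bool) st i : state m n := step r j (fun=> x) t st i.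

Definition chosen st i := choose_set (prices st) (supply st) (t i).

(** The expected welfare of the bidders in [s], unfolded one coin at a time so that bounds follow by
    induction on [s]. *)
Fixpoint run_welfare s st : R :=
  if s is i :: s' then
    q * (value (t i) (chosen st i) + run_welfare s' (coin_step true st i))
    + (1 - q) * run_welfare s' (coin_step false st i)
  else 0.

Lemma run_welfare_ge0 s st : 0 <= run_welfare s st.
Proof.
elim: s st => [|i s IH] st /=; first lra.
have := IH (coin_step true st i); have := IH (coin_step false st i).
have := value_ge0 (t i) (chosen st i); nra.
Qed.

Lemma expect_run s st : uniq s -> j \notin s ->
  expect q (fun c : {ffun 'I_n -> bool} =>
    \sum_(i <- s) value (t i) (alloc (foldl (step r j c t) st s) i)) =
  run_welfare s st.
Proof.
elim: s st => [|i s IH] st.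
  move=> _ _ /=; rewrite -[RHS](expect_const n q); apply: eq_expect => c.
  by rewrite big_nil.
rewrite [uniq _]/= inE negb_or eq_sym => /andP[is_ us] /andP[ij js].
have fixed c x : \sum_(k <- i :: s) value (t k)
      (alloc (foldl (step r j (set_coin c i x) t) st (i :: s)) k) =
    value (t i) (if x then chosen st i else set0) +
    \sum_(k <- s) value (t k) (alloc (foldl (step r j c t) (coin_step x st i) s) k).
  rewrite big_cons /= alloc_foldl_step //= eqxx (negbTE ij) ffunE eqxx.
  congr (_ + _); apply: eq_bigr => l _; congr (value _ (alloc _ _)).
  rewrite (_ : step _ _ _ _ _ i = coin_step x st i); last first.
    by rewrite /coin_step /step ffunE eqxx.
  (* The bidders of [s] differ from [i], so the rest of the run does not read the fixed coin. *)
  apply: eq_foldl_step => l' l's; split=> //; rewrite ffunE.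
  by case: eqVneq l's is_ => // -> ->.
rewrite (expect_resample _ i).
under eq_expect => c do rewrite !fixed.
rewrite expectD !expectZ !expectD !expect_const !IH //= (value_set0 (t_valid i)).
ring.
Qed.

Section Potential.
Variable V : R.
Hypotheses (V_gt0 : 0 < V) (t_le : forall i, vmax (t i) <= V).

(* At least the number of further bidders who can afford a good of price p. *)
Definition requests_left (p : R) : R := 1 + INR b * (ln (V / p) / ln 2).

(* Bounds the probability that a good of price p and remaining supply s is
   exhausted by the end of the run. *)
Definition potential (p : R) (s : nat) : R :=
  (requests_left p * q) ^ s / INR (fact s).

(** Positive prices give the logarithm its meaning, and nonnegative request numbers keep the
    potentials nonnegative. *)
Definition live st := forall e, 0 < prices st e /\ 0 <= requests_left (prices st e).

Let ln2_gt0 : 0 < ln 2. Proof. by have := ln2_ge; lra. Qed.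
Let bp : 0 < INR b. Proof. exact: INR_gt0. Qed.

(** One request multiplies the price by r = 2^(1/b), which lowers log2 (V / p) by 1/b. *)
Lemma requests_left_step p : 0 < p -> requests_left (p * r) = requests_left p - 1.
Proof.
move=> p0; rewrite /requests_left.
have -> : ln (V / (p * r)) = ln (V / p) - / INR b * ln 2.
  have rp : 0 < r by apply: exp_pos.
  have -> : V / (p * r) = V / p * / r by field; lra.
  rewrite ln_mult; try exact: Rinv_0_lt_compat; last first.
    by apply: Rdiv_lt_0_compat.
  by rewrite ln_Rinv // /r /Rpower ln_exp; ring.
by field; lra.
Qed.

Lemma requests_left_ge1 p : 0 < p -> p <= V -> 1 <= requests_left p.
Proof.
move=> p0 pV; rewrite /requests_left.
have h : 1 <= V / p.
  by apply: (Rmult_le_reg_r p) => //; rewrite /Rdiv Rmult_assoc Rinv_l; lra.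
have : 0 <= ln (V / p).
  by rewrite -ln_1; case: h => [h|<-]; [apply/Rlt_le/ln_increasing; lra | lra].
move=> h0; have := Rle_mult_inv_pos _ _ h0 ln2_gt0.
rewrite -/(Rdiv _ _); nra.
Qed.

Lemma potential_ge0 p (s : nat) : 0 <= requests_left p -> 0 <= potential p s.
Proof.
move=> h; apply: Rle_mult_inv_pos (INR_fact_lt_0 s); apply: pow_le.
by apply: Rmult_le_pos; lra.
Qed.

(** With q^(s+1) / (s+1)! factored out and y requests left, the claim reads (s+1)(y-1)^s +
    (1-q)(y-1)^(s+1) <= y^(s+1), which [pow_succ_ge] implies. *)
Lemma potential_step p (s : nat) : 0 < p -> p <= V ->
  q * potential (p * r) s + (1 - q) * potential (p * r) s.+1 <= potential p s.+1.
Proof.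
move=> p0 pV; rewrite /potential requests_left_step //.
have := requests_left_ge1 p0 pV; set y := requests_left p => y1.
have h := @pow_succ_ge s (y - 1) ltac:(lra).
have fp := INR_fact_lt_0 s; have sp := @INR_gt0 s.+1 isT.
have -> : INR (fact s.+1) = INR s.+1 * INR (fact s) by rewrite -mult_INR.
rewrite (_ : y - 1 + 1 = y) in h; last ring.
have ys := pow_le (y - 1) s.+1 ltac:(lra); have qs := pow_le q s.+1 ltac:(lra).
apply: (Rmult_le_reg_r (INR s.+1 * INR (fact s))); first exact: Rmult_lt_0_compat.
rewrite !Rpow_mult_distr.
have -> : (q * ((y - 1) ^ s * q ^ s / INR (fact s)) + (1 - q) *
   ((y - 1) ^ s.+1 * q ^ s.+1 / (INR s.+1 * INR (fact s)))) *
   (INR s.+1 * INR (fact s)) =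
   q ^ s.+1 * (INR s.+1 * (y - 1) ^ s + (1 - q) * (y - 1) ^ s.+1).
  by rewrite -!tech_pow_Rmult; field; lra.
have -> : y ^ s.+1 * q ^ s.+1 / (INR s.+1 * INR (fact s)) *
   (INR s.+1 * INR (fact s)) = q ^ s.+1 * y ^ s.+1 by field; lra.
by apply: Rmult_le_compat_l => //; nra.
Qed.

Lemma chosen_price_le st i e : live st -> e \in chosen st i -> prices st e <= V.
Proof.
move=> lv eS; apply: Rle_trans (t_le i); apply: Rle_trans (value_le_vmax _ (chosen st i)).
apply: Rle_trans (choose_set_price _ _ _); rewrite price_sumE.
rewrite (bigD1 e) //= -[X in X <= _]Rplus_0_r; apply: Rplus_le_compat_l.
by apply: sumR_ge0 => e' _; apply/Rlt_le; case: (lv e').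
Qed.

Lemma live_step st i x : live st -> live (coin_step x st i).
Proof.
move=> lv e /=; case: (lv e) => p0 rp; case: ifP => // eS; split.
  by apply: Rmult_lt_0_compat => //; apply: exp_pos.
rewrite requests_left_step //.
have := requests_left_ge1 p0 (chosen_price_le lv eS); lra.
Qed.

Definition st_potential st e := potential (prices st e) (supply st e).

Lemma st_potential_step st i e : live st -> i != j ->
  q * st_potential (coin_step true st i) e
  + (1 - q) * st_potential (coin_step false st i) e <= st_potential st e.
Proof.
move=> lv /negbTE ij; rewrite /st_potential /= ij /= -/(chosen st i) inE.
case: ifP => [eS|_]; last lra.
have := subsetP (choose_set_avail _ _ _) _ eS; rewrite inE.
case: (supply st e) => // s _; apply: potential_step; first by case: (lv e).
exact: chosen_price_le eS.
Qed.

Section Comparison.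
Variable Y : 'I_n -> {set 'I_m}.

(** Double counting: each good lies in at most [b] of the sets. *)
Lemma sum_sets_le s (f : 'I_m -> R) : (forall e, 0 <= f e) ->
  (forall e, leq (count (fun i => e \in Y i) s) b) ->
  \sum_(i <- s) \sum_(e in Y i) f e <= INR b * \sum_e f e.
Proof.
move=> f0 cnt; rewrite (eq_bigr (fun i => \sum_e if e \in Y i then f e else 0));
  last by move=> i _; rewrite big_mkcond.
rewrite exchange_big /= big_distrr /=; apply: sumR_le => e _.
rewrite -big_mkcond sumR_const; apply: Rmult_le_compat_r => //.
by apply/le_INR/leP.
Qed.

Definition surplus s (f : 'I_m -> R) : R :=
  \sum_(i <- s) value (t i) (Y i) * (1 - \sum_(e in Y i) f e).

(** The surplus is affine in [f] and, values being nonnegative, decreasing. *)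
Lemma surplus_step s (f1 f0 f : 'I_m -> R) :
  (forall e, q * f1 e + (1 - q) * f0 e <= f e) ->
  surplus s f <= q * surplus s f1 + (1 - q) * surplus s f0.
Proof.
move=> H; rewrite /surplus !big_distrr -big_split /=; apply: sumR_le => i _.
have : \sum_(e in Y i) (q * f1 e + (1 - q) * f0 e) <= \sum_(e in Y i) f e.
  by apply: sumR_le.
rewrite big_split -!big_distrr /=; have := value_ge0 (t i) (Y i); nra.
Qed.

(* Either Y i is unavailable, and then its potential is at least 1, or it is
   too expensive, or it competes for the choice of bidder i. *)
Lemma chosen_surplus st i : live st ->
  value (t i) (Y i) * (1 - \sum_(e in Y i) st_potential st e)
    - price_sum (prices st) (Y i) <= value (t i) (chosen st i).
Proof.
move=> lv.
have p0 e : 0 <= prices st e by apply/Rlt_le; case: (lv e).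
have f0 e : 0 <= st_potential st e by apply: potential_ge0; case: (lv e).
have v0 := value_ge0 (t i) (Y i); have S0 := value_ge0 (t i) (chosen st i).
have P0 : 0 <= price_sum (prices st) (Y i) by rewrite price_sumE; apply: sumR_ge0.
have F0 : 0 <= \sum_(e in Y i) st_potential st e by apply: sumR_ge0.
case YU: (Y i \subset avail (supply st)); last first.
  move/negbT: YU => /subsetPn[e eY]; rewrite inE -ltnNge ltnS leqn0 => /eqP s0.
  have : 1 <= \sum_(e in Y i) st_potential st e; last by nra.
  rewrite (bigD1 e) //= {1}/st_potential s0 /potential /= Rdiv_1_r.
  rewrite -[X in X <= _]Rplus_0_r; apply: Rplus_le_compat_l.
  exact: sumR_ge0.
case: (Rle_lt_dec (price_sum (prices st) (Y i)) (value (t i) (Y i))) => h; last nra.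
have := choose_set_ge p0 YU h; rewrite -/(chosen st i); nra.
Qed.

(** The value of the set chosen by a bidder pays both for his surplus and for the price rise seen by
    later bidders, hence the factor 2. Prices rise for either coin while the value is won only with
    probability [q], hence the factor [q]. *)
Lemma run_welfare_lb s st : live st -> j \notin s ->
  (forall e, leq (count (fun i => e \in Y i) s) b) ->
  q * (surplus s (st_potential st) - \sum_(i <- s) price_sum (prices st) (Y i))
  <= 2 * run_welfare s st.
Proof.
elim: s st => [|i s IH] st lv.
  by move=> _ _; rewrite /surplus !big_nil /=; lra.
rewrite inE negb_or eq_sym => /andP[ij js] cnt.
have {}cnt e : leq (count (fun i => e \in Y i) s) b.
  by apply: leq_trans (cnt e); rewrite /= leq_addl.
have h1 := IH _ (live_step i true lv) js cnt.
have h0 := IH _ (live_step i false lv) js cnt.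
have hS := surplus_step s (fun e => st_potential_step e lv ij).
have hi := chosen_surplus i lv.
rewrite /surplus !big_cons -/(surplus s _) /=.
(* A chosen good gets dearer by the factor r and lies in at most b later sets; as b (r - 1) <= 1,
   the total rise is at most the price of the chosen set, hence at most its value. *)
have hP : \sum_(k <- s) price_sum (prices (coin_step true st i)) (Y k) <=
    \sum_(k <- s) price_sum (prices st) (Y k) + value (t i) (chosen st i).
  pose f e := if e \in chosen st i then prices st e * (r - 1) else 0.
  have r1 : 0 <= r - 1.
    have ib := Rinv_0_lt_compat _ bp; have := Rpower_lt 2 0 (/ INR b).
    by rewrite Rpower_O -/r; lra.
  have f0 e : 0 <= f e.
    rewrite /f; case: ifP => _; last lra.
    by apply: Rmult_le_pos => //; apply/Rlt_le; case: (lv e).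
  have -> : \sum_(k <- s) price_sum (prices (coin_step true st i)) (Y k) =
      \sum_(k <- s) price_sum (prices st) (Y k) + \sum_(k <- s) \sum_(e in Y k) f e.
    rewrite -big_split; apply: eq_bigr => l _; rewrite !price_sumE -big_split.
    apply: eq_bigr => e _ /=; rewrite /f -/(chosen st i); case: ifP => _; ring.
  apply: Rplus_le_compat_l; apply: Rle_trans (sum_sets_le f0 cnt) _.
  apply: Rle_trans (choose_set_price _ _ _); rewrite price_sumE.
  rewrite /f -big_mkcond -big_distrl /= -/(chosen st i).
  have P0 : 0 <= \sum_(e in chosen st i) prices st e.
    by apply: sumR_ge0 => e _; apply/Rlt_le; case: (lv e).
  have := Rmult_le_compat_l _ _ _ P0 (Rpower_2_inv_le b_gt0); rewrite -/r.
  set Q := \big[_/_]_(e in _) _. lra.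
have hP' : \sum_(k <- s) price_sum (prices (coin_step false st i)) (Y k) =
  \sum_(k <- s) price_sum (prices (coin_step true st i)) (Y k) by [].
rewrite hP' in h0; move: h1 h0 hS hi hP.
set W1 := run_welfare s (coin_step true st i).
set W0 := run_welfare s (coin_step false st i).
set A1 := surplus s _; set A0 := surplus s _; set A := surplus s _.
set B' := \sum_(k <- s) price_sum (prices (coin_step _ _ _)) _.
set B := \sum_(k <- s) _; set x := _ * (1 - _); set P := price_sum _ _.
set w := value _ _ => h1 h0 hS hi hP.
(* The two induction hypotheses are averaged with weights [q] and [1 - q], then the bounds for the
   current bidder are added. *)
have g1 := Rmult_le_compat_l q _ _ (proj1 q01) h1.
have g0 := Rmult_le_compat_l (1 - q) _ _ ltac:(lra) h0.
have g2 := Rmult_le_compat_l q _ _ (proj1 q01)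
  (Rplus_le_compat _ _ _ _ hS (Rplus_le_compat _ _ _ _ hi hP)).
nra.
Qed.

End Comparison.
End Potential.
End ExpectedRun.

(** * Reduction to small sets and the approximation bound *)

Lemma value_small_subset m k d (D : decl m) (X : {set 'I_m}) : valid_decl k D ->
  (forall p, List.In p D -> 0 < p.2 -> leq #|p.1| d) ->
  exists Y : {set 'I_m}, [/\ Y \subset X, leq #|Y| d & value D Y = value D X].
Proof.
move=> valD smallD; have X0 := value_ge0 D X.
case: (Rle_lt_dec (value D X) 0) => [h|h].
  by exists set0; rewrite sub0set cards0 (value_set0 valD); split=> //; lra.
(* The demanded set attaining a positive value has positive value itself, so it has at most [d]
   goods. *)
have [x [xD xX xv]] := value_attained h; exists x.1; split=> //.
  by apply: smallD => //; rewrite xv.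
apply: Rle_antisym; first exact: value_mono.
by rewrite -xv; apply: value_ge.
Qed.

Lemma sum_others n (F : 'I_n -> R) j :
  \sum_i F i = F j + \sum_(i <- others j) F i.
Proof. by rewrite (bigD1 j) //= /others big_filter big_enum_cond. Qed.

Section Approximation.
Variables (m n b k d : nat) (eps : R) (t : 'I_n -> decl m) (j : 'I_n).
Hypotheses (m_gt0 : leq 1 m) (b_gt0 : leq 1 b) (d_gt0 : leq 1 d).
Hypotheses (eps01 : 0 < eps < 1) (t_valid : forall i, valid_decl k (t i)).
Hypothesis t_small : forall i p, List.In p (t i) -> 0 < p.2 -> leq #|p.1| d.
Hypothesis topj : top_bidder t = Some j.

Let V := vmax (t j).
Let p0 := base_price m b eps V.
Let q := qprob b m d.
Let r := Rpower 2 (/ INR b).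
Let D := Rpower (INR d) (/ INR b).
Let st0 : state m n := @init_state m n b p0.
Let Sj := chosen t st0 j.
Let st1 := coin_step b t j true st0 j.
(** Potential bound for a good of the top bidder's set, of which b - 1 copies remain. *)
Let pi_top := (max_requests m b * q) ^ b.-1 / INR (fact b.-1).

Let q01 : 0 <= q <= 1.
Proof. by split; [apply/Rlt_le/qprob_gt0 | apply: qprob_le1]. Qed.

(** The top bidder wins value [V] whatever the coins, and the others continue from [st1]. *)
Lemma exp_welfareE :
  exp_welfare m n b d eps t = V + run_welfare b t j q (others j) st1.
Proof.
have V_top : value (t j) Sj = V by apply: choose_set_top.
rewrite -(expect_run b q t_valid st1 (uniq_others j)); last first.
  by rewrite mem_others eqxx.
rewrite -{1}(expect_const n q V) -expectD /exp_welfare RsumE big_enum /=.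
apply: eq_expect => c; rewrite /welfare RsumE big_enum /= (sum_others _ j).
congr (_ + _); first by rewrite (mech_top _ _ _ topj).
apply: eq_bigr => i _; rewrite (mechE _ _ _ topj) /=.
by congr (value _ (alloc (foldl _ _ _) _)); rewrite /st1 /coin_step /step eqxx.
Qed.

Hypothesis V_gt0 : 0 < V.

Let p0_gt0 : 0 < p0.
Proof.
have bp := INR_gt0 b_gt0; have mp := INR_gt0 m_gt0.
apply: Rdiv_lt_0_compat; first nra.
by apply: Rmult_lt_0_compat; lra.
Qed.

Let p0_le : p0 <= V.
Proof.
have := base_price_sum_le b_gt0 eps01 m_gt0 (Rlt_le _ _ V_gt0); rewrite -/p0.
have := INR_ge1 b_gt0; have := INR_ge1 m_gt0 => m1 b1.
have : p0 <= INR m * p0 by nra.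
set x := INR m * p0; nra.
Qed.

Let live0 : live b V st0.
Proof. by move=> e; split=> //=; have := requests_left_ge1 b_gt0 p0_gt0 p0_le; lra. Qed.

Let t_le i : vmax (t i) <= V.
Proof. exact: top_bidder_max topj. Qed.

Let live1 : live b V st1.
Proof. exact: live_step. Qed.

(** The factor 1 + eps in the base price only lowers V / p0 below 4bm. *)
Lemma requests_left_init : requests_left b V p0 <= max_requests m b.
Proof.
have bp := INR_gt0 b_gt0; have mp := INR_gt0 m_gt0; have l2 := ln2_ge.
apply: Rplus_le_compat_l; apply: Rmult_le_compat_l; first lra.
apply: Rmult_le_compat_r; first by apply/Rlt_le/Rinv_0_lt_compat; lra.
have -> : V / p0 = 4 * INR b * INR m * / (1 + eps).
  by rewrite /p0 /base_price; field; lra.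
have bm : 0 < 4 * INR b * INR m by apply: Rmult_lt_0_compat; lra.
apply/Rlt_le/ln_increasing.
  by apply: Rmult_lt_0_compat => //; apply: Rinv_0_lt_compat; lra.
rewrite -[X in _ < X]Rmult_1_r; apply: Rmult_lt_compat_l => //.
by rewrite -[X in _ < X]Rinv_1; apply: Rinv_lt_contravar; lra.
Qed.

Lemma pow_fact_mono x y s : 0 <= x -> x <= y ->
  x ^ s / INR (fact s) <= y ^ s / INR (fact s).
Proof.
move=> x0 xy; apply: Rmult_le_compat_r; last exact: pow_incr.
exact/Rlt_le/Rinv_0_lt_compat/INR_fact_lt_0.
Qed.

Lemma pi_top_ge0 : 0 <= pi_top.
Proof.
apply: Rle_mult_inv_pos (INR_fact_lt_0 _); apply: pow_le.
apply: Rmult_le_pos; last by lra.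
have := requests_left_init; have := requests_left_ge1 b_gt0 p0_gt0 p0_le; lra.
Qed.

(** Goods of [Sj] have lost a copy, and the rise of their price is discarded; the others still have
    price [p0] and [b] copies. *)
Lemma potential_init e :
  st_potential b q V st1 e <= 5 / 9 / INR d + (if e \in Sj then pi_top else 0).
Proof.
have := requests_left_ge1 b_gt0 p0_gt0 p0_le => r1; have ri := requests_left_init.
have d0 : 0 <= 5 / 9 / INR d by apply: Rle_mult_inv_pos; [lra | apply: INR_gt0].
rewrite /st_potential /= eqxx /= -/Sj; case: ifP => eS.
  have := requests_left_step b_gt0 V_gt0 p0_gt0; rewrite -/r => rs.
  have : potential b q V (p0 * r) b.-1 <= pi_top; last lra.
  apply: pow_fact_mono; first by apply: Rmult_le_pos; lra.
  by apply: Rmult_le_compat_r; lra.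
rewrite Rplus_0_r; apply: Rle_trans (requests_pow_le_supply m_gt0 b_gt0 d_gt0).
apply: pow_fact_mono; first by apply: Rmult_le_pos; lra.
by apply: Rmult_le_compat_r; lra.
Qed.

Variables (X : 'I_n -> {set 'I_m}) (feasX : feasible b X).

Lemma count_others (Y : 'I_n -> {set 'I_m}) : (forall i, Y i \subset X i) ->
  forall e, leq (count (fun i => e \in Y i) (others j)) b.
Proof.
move=> YX e; apply: leq_trans (feasX e); rewrite -size_filter cardE.
apply: uniq_leq_size => [|i]; first by rewrite filter_uniq ?uniq_others.
by rewrite mem_filter mem_enum inE => /andP[/(subsetP (YX i))].
Qed.

(** The selected pair could carry a declared value below that of its set. A pair inside the set that
    attains [V] is also a candidate, so the selected one has value at least [V], which is positive,
    and [t_small] applies. *)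
Lemma card_Sj : leq #|Sj| d.
Proof.
have V_top : value (t j) Sj = V by apply: choose_set_top.
move: V_top; rewrite /Sj /chosen; case: choose_setP => [_|x xD cx xmax] xV.
  by rewrite cards0.
have [y [yD yS yV]] : exists y, [/\ List.In y (t j), y.1 \subset x.1 & y.2 = V].
  by rewrite -xV; apply: value_attained; rewrite xV.
apply: (t_small xD); apply: Rlt_le_trans (_ : y.2 <= _); first by rewrite yV.
apply: xmax => //; case/andP: cx => xU /RlebP px.
rewrite /candidate (subset_trans yS xU); apply/RlebP.
rewrite yV -xV; apply: Rle_trans (value_ge xD (subxx _)); apply: Rle_trans px.
by rewrite !price_sumE; apply: sumR_sub => // e; apply: Rlt_le.
Qed.

(** Base prices contribute at most V/2; the rise on [Sj] contributes at most its price, hence at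
    most V. *)
Lemma prices_init_sum : INR b * \sum_e prices st1 e <= 3 / 2 * V.
Proof.
have -> : \sum_e prices st1 e =
    INR m * p0 + (r - 1) * price_sum (prices st0) Sj.
  rewrite price_sumE big_distrr [X in _ + X]big_mkcond /=.
  have -> : INR m * p0 = \sum_(e : 'I_m) p0.
    by rewrite -big_enum sumR_const count_predT -cardE card_ord.
  rewrite -big_split; apply: eq_bigr => e _ /=; rewrite -/(chosen t st0 j) -/Sj.
  by case: ifP => _; rewrite /r; ring.
have := base_price_sum_le b_gt0 eps01 m_gt0 (Rlt_le _ _ V_gt0); rewrite -/p0.
have hS : price_sum (prices st0) Sj <= V.
  by apply: Rle_trans (choose_set_price _ _ _) (value_le_vmax _ _).
have S0 : 0 <= price_sum (prices st0) Sj.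
  by rewrite price_sumE; apply: sumR_ge0 => e _; apply: Rlt_le.
have := Rmult_le_compat_r _ _ _ S0 (Rpower_2_inv_le b_gt0); rewrite -/r.
lra.
Qed.

(** At most d goods per set cost the share 5/9 of its value and leave 4/9. The goods of [Sj], at
    most d and each in at most b sets, add potential at most 20 D in total, weighted by values at
    most V. *)
Lemma surplus_init (Y : 'I_n -> {set 'I_m}) :
  (forall i, Y i \subset X i) -> (forall i, leq #|Y i| d) ->
  4 / 9 * (\sum_(i <- others j) value (t i) (Y i)) - 20 * D * V
  <= surplus t Y (others j) (st_potential b q V st1).
Proof.
move=> YX Yd; have dp := INR_gt0 d_gt0; have bp := INR_gt0 b_gt0.
pose f e := if e \in Sj then pi_top else 0.
have f0 e : 0 <= f e by rewrite /f; case: ifP => _; [apply: pi_top_ge0 | lra].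
have term i : 4 / 9 * value (t i) (Y i) - V * \sum_(e in Y i) f e <=
    value (t i) (Y i) * (1 - \sum_(e in Y i) st_potential b q V st1 e).
  have hY : \sum_(e in Y i) st_potential b q V st1 e <= 5 / 9 + \sum_(e in Y i) f e.
    apply: Rle_trans (_ : \sum_(e in Y i) (5 / 9 / INR d + f e) <= _).
      by apply: sumR_le => e _; apply: potential_init.
    rewrite big_split /= sumR_card; apply: Rplus_le_compat_r.
    have : INR #|Y i| <= INR d by apply/le_INR/leP.
    move=> h; apply: Rle_trans (_ : INR d * (5 / 9 / INR d) <= _).
      by apply: Rmult_le_compat_r => //; apply: Rle_mult_inv_pos; lra.
    by apply: Req_le; field; lra.
  have F0 : 0 <= \sum_(e in Y i) f e by apply: sumR_ge0.
  have v0 := value_ge0 (t i) (Y i).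
  have vV : value (t i) (Y i) <= V by apply: Rle_trans (value_le_vmax _ _) (t_le i).
  have := Rmult_le_compat_l _ _ _ v0 hY; have := Rmult_le_compat_r _ _ _ F0 vV.
  lra.
have hf : \sum_(i <- others j) \sum_(e in Y i) f e <= 20 * D.
  apply: Rle_trans (sum_sets_le f0 (count_others YX)) _.
  rewrite /f -big_mkcond sumR_card.
  apply: Rle_trans (requests_pow_pred_le m_gt0 b_gt0 d_gt0); rewrite -/q -/pi_top.
  have : INR #|Sj| <= INR d by apply/le_INR/leP/card_Sj.
  have pb := Rmult_le_pos _ _ pi_top_ge0 (Rlt_le _ _ bp).
  move=> h; have := Rmult_le_compat_l _ _ _ pb h.
  set x := INR #|_|; lra.
have := sumR_le (others j) (P := xpredT) (fun i _ => term i).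
rewrite -/(surplus _ _ _ _) => h; apply: Rle_trans h.
have -> : \sum_(i <- others j)
      (4 / 9 * value (t i) (Y i) - V * \sum_(e in Y i) f e) =
    4 / 9 * (\sum_(i <- others j) value (t i) (Y i)) +
    - V * (\sum_(i <- others j) \sum_(e in Y i) f e).
  rewrite !big_distrr -big_split; apply: eq_bigr => i _ /=; ring.
have := Rmult_le_compat_l _ _ _ (Rlt_le _ _ V_gt0) hf; lra.
Qed.

Lemma welfare_le :
  welfare t X <= 104 * D * (1 + ln (INR b * INR m)) * exp_welfare m n b d eps t.
Proof.
(* Passing to subsets with at most [d] goods and the same values keeps feasibility. *)
have /fin_all_exists[Y HY] i := value_small_subset (X i) (t_valid i) (@t_small i).
have YX i : Y i \subset X i by case: (HY i).
have Yd i : leq #|Y i| d by case: (HY i).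
have -> : welfare t X = value (t j) (Y j) + \sum_(i <- others j) value (t i) (Y i).
  rewrite /welfare RsumE big_enum /= -(sum_others (fun i => value (t i) (Y i)) j).
  by apply: eq_bigr => i _; case: (HY i).
rewrite exp_welfareE; have js : j \notin others j by rewrite mem_others eqxx.
have := run_welfare_lb b_gt0 q01 V_gt0 t_le live1 js (count_others YX).
have := run_welfare_ge0 b t j q01 (others j) st1.
have vj : value (t j) (Y j) <= V by apply: value_le_vmax.
have := surplus_init YX Yd.
have B_le : \sum_(i <- others j) price_sum (prices st1) (Y i) <= 3 / 2 * V.
  apply: Rle_trans prices_init_sum; under eq_bigr => i _ do rewrite price_sumE.
  by apply: sum_sets_le (count_others YX) => e; apply/Rlt_le; case: (live1 e).
have D1 : 1 <= D := Rpower_inv_ge1 b_gt0 d_gt0.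
have l0 := ln_bm_ge0 m_gt0 b_gt0.
have iq := inv_qprob_le m_gt0 b_gt0 d_gt0; rewrite -/D -/q in iq.
have q0 : 0 < q by apply: qprob_gt0.
move: B_le; set B := \sum_(i <- _) price_sum _ _; set O := \sum_(i <- _) value _ _.
set A := surplus _ _ _ _; set W := run_welfare _ _ _ _ _ _.
set l := ln _ in iq l0 *; set v := value _ _ in vj *.
move=> B_le A_ge W0 main.
have main' : A - B <= 24 * (D * (1 + l)) * W.
  have -> : A - B = / q * (q * (A - B)) by field; lra.
  apply: Rle_trans (_ : / q * (2 * W) <= _).
    by apply: Rmult_le_compat_l => //; apply/Rlt_le/Rinv_0_lt_compat.
  have := Rmult_le_compat_r (2 * W) _ _ ltac:(lra) iq; lra.
have DL : D <= D * (1 + l) by nra.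
have h1 := Rmult_le_compat_r V _ _ ltac:(lra) DL.
have h2 := Rmult_le_compat_r V _ _ ltac:(lra) D1.
have h3 : 0 <= D * (1 + l) * W by apply: Rmult_le_pos; nra.
(* From O <= 9/4 (A + 20 D V) and A <= 3/2 V + 24 D (1 + l) W, the coefficients of V and W stay
   below 50 D and at 54 D (1 + l), so 104 suffices. *)
have -> : 104 * D * (1 + l) * (V + W) =
  104 * (D * (1 + l) * V) + 104 * (D * (1 + l) * W) by ring.
lra.
Qed.

End Approximation.

(** * Degenerate inputs and the combined statement *)

Lemma exp_welfare_ge0 m n b d eps (t : 'I_n -> decl m) :
  leq 1 m -> leq 1 b -> leq 1 d -> 0 <= exp_welfare m n b d eps t.
Proof.
move=> m_gt0 b_gt0 d_gt0; rewrite /exp_welfare RsumE; apply: sumR_ge0 => c _.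
have q0 := qprob_gt0 m_gt0 b_gt0 d_gt0; have q1 := qprob_le1 m_gt0 b_gt0 d_gt0.
apply: Rmult_le_pos; last first.
  by rewrite /welfare RsumE; apply: sumR_ge0 => i _; apply: value_ge0.
rewrite coin_weightE; apply: (big_ind (fun x => 0 <= x)) => [|x y|i _]; first lra.
  exact: Rmult_le_pos.
by case: ifP => _; lra.
Qed.

Unset Implicit Arguments.
Set Strict Implicit.

Theorem theorem6 (eps : R) (Heps : 0 < eps < 1) :
  (forall m n b k : nat, leq 1 b ->
     universally_truthful m n b k eps /\
     (forall (c : {ffun 'I_n -> bool}) (bids : 'I_n -> decl m),
        feasible b (mech m n b eps c bids))) /\
  exists C : R, 0 < C /\
    forall (m n b k d : nat) (t : 'I_n -> decl m),
      leq 1 m -> leq 1 b -> leq 1 d ->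
      (forall i, valid_decl k (t i)) ->
      (forall i p, List.In p (t i) -> 0 < p.2 -> leq #|p.1| d) ->
      forall X : 'I_n -> {set 'I_m}, feasible b X ->
        welfare t X <=
          C * Rpower (INR d) (/ INR b) * (1 + ln (INR b * INR m))
            * exp_welfare m n b d eps t.
Proof.
split=> [m n b k b_gt0|].
  split=> [c|c bids]; [exact: mech_truthful | exact: mech_feasible].
exists 104; split; first lra.
move=> m n b k d t m_gt0 b_gt0 d_gt0 t_valid t_small X feasX.
(* If all values vanish, or there is no bidder, the optimum is 0 and only a nonnegative right-hand
   side is needed; the potential argument requires a positive top value. *)
have triv : (forall i, vmax (t i) <= 0) -> welfare t X <=
    104 * Rpower (INR d) (/ INR b) * (1 + ln (INR b * INR m)) *
    exp_welfare m n b d eps t.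
  move=> t0; apply: Rle_trans (_ : 0 <= _).
    rewrite /welfare RsumE big1 => [|i _]; first lra.
    have := value_le_vmax (t i) (X i); have := value_ge0 (t i) (X i).
    by have := t0 i; lra.
  have := Rpower_inv_ge1 b_gt0 d_gt0; have := ln_bm_ge0 m_gt0 b_gt0 => l0 D1.
  apply: Rmult_le_pos (exp_welfare_ge0 _ _ m_gt0 b_gt0 d_gt0).
  by apply: Rmult_le_pos; lra.
have := top_bidderP t; case topj: (top_bidder t) => [j|] tmax; last first.
  by apply: triv => i; case: (tmax i).
case: (Rle_lt_dec (vmax (t j)) 0) => [V0|V_gt0].
  by apply: triv => i; have [] := tmax i; lra.
exact: welfare_le topj V_gt0 _ feasX.
Qed.
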